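(* Let $\Omega\subseteq\mathbb{R}^n$ be open. The set $\mathcal{M}^{\mathrm{c}}(\Omega)$ of moderate elements is a subalgebra of $\mathcal{B}^{\mathrm{c}}(\Omega)$, and the set $\mathcal{N}^{\mathrm{c}}(\Omega)$ of negligible elements is an ideal in $\mathcal{M}^{\mathrm{c}}(\Omega)$.
   Context: Notation: $\mathbb{R}^+=[0,\infty)$. $K\Subset L$ means that $K$ is compact and contained in the interior of $L$. $\mathcal{U}_x(\Omega)$ is the set of open neighborhoods of $x$ in $\Omega$; $\mathcal{D}(\mathbb{R}^n)$ is the space of (complex-valued) test functions. $U(\Omega)=\{(\varphi,x)\in\mathcal{D}(\mathbb{R}^n)\times\Omega : x+\operatorname{supp}\varphi\subseteq\Omega\}$. $\mathcal{B}^{\mathrm{c}}(\Omega)$ is the set of all maps $R:U(\Omega)\to\mathbb{C}$ such that $R(\varphi,\cdot)$ is smooth (on the open set of $x$ with $(\varphi,x)\in U(\Omega)$) for each fixed $\varphi$; it is an algebra with pointwise operations. $\|g\|_{K,m}=\sup_{x\in K,|\alpha|\le m}|\partial^\alpha g(x)|$; $\|\varphi\|_c=\sup_{x\in\mathbb{R}^n,|\alpha|\le c}|\partial^\alpha\varphi(x)|$ for $\varphi\in\mathcal{D}(\mathbb{R}^n)$. For $\varphi\in\mathcal{D}(\mathbb{R}^n)$ let $\varphi^\star(x)(y)=\varphi(y-x)$, and let $\vec\delta(x)=\delta_x$; for $B$ a set of smooth functions, $\|\varphi^\star-\vec\delta\|_{K,c;B}=\sup_{x\in K,|\alpha|\le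 c,f\in B}\left|\int f(y)\,\partial_x^\alpha(\varphi(y-x))\,dy-\partial^\alpha f(x)\right|$. $\mathcal{P}_0=\mathbb{R}^+[y_0]$ (polynomials with coefficients in $\mathbb{R}^+$), $\mathcal{I}_0=\{\lambda\in\mathbb{R}^+[y_0,z_0] : \lambda(y_0,0)=0\}$. $R\in\mathcal{B}^{\mathrm{c}}(\Omega)$ is moderate ($R\in\mathcal{M}^{\mathrm{c}}(\Omega)$) if: $(\forall x\in\Omega)(\exists U\in\mathcal{U}_x(\Omega))(\forall K,L\Subset U: K\Subset L)(\forall m\in\mathbb{N}_0)(\exists c\in\mathbb{N}_0)(\exists\lambda\in\mathcal{P}_0)(\forall\varphi\in\mathcal{D}(\mathbb{R}^n): K+\operatorname{supp}\varphi\subseteq L)$: $\|R(\varphi,\cdot)\|_{K,m}\le\lambda(\|\varphi\|_c)$. $R$ is negligible ($R\in\mathcal{N}^{\mathrm{c}}(\Omega)$) if: $(\forall x\in\Omega)(\exists U\in\mathcal{U}_x(\Omega))(\forall K,L\Subset U: K\Subset L)(\forall m\in\mathbb{N}_0)(\exists c\in\mathbb{N}_0)(\exists\lambda\in\mathcal{I}_0)(\exists B\subseteq C^\infty(U)\text{ bounded})(\forall\varphi\in\mathcal{D}(\mathbb{R}^n): K+\operatorname{supp}\varphi\subseteq L)$: $\|R(\varphi,\cdot)\|_{K,m}\le\lambda(\|\varphi\|_c,\|\varphi^\star-\vec\delta\|_{K,c;B})$. *)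

(* Defs.v *)
From HB Require Import structures.
From mathcomp Require Import all_boot all_order all_algebra.
From mathcomp Require Import all_classical all_reals all_analysis.
From mathcomp Require Import complex.

Set Implicit Arguments.
Unset Strict Implicit.
Unset Printing Implicit Defensive.
Import Order.TTheory GRing.Theory Num.Theory.
Import numFieldNormedType.Exports.
Local Open Scope classical_set_scope.
Local Open Scope ring_scope.

(* The library has binary product measures and the product sigma-algebra on
   [n.-tuple T], but no Lebesgue measure on R^n: it is built here as the n-fold
   product of [lebesgue_measure]. *)
Section power_measure_step.
Context d (T : measurableType d) (R : realType) (n : nat).
Variable m : {sigma_finite_measure set T -> \bar R}.
Variable mu : {sigma_finite_measure set (n.-tuple T) -> \bar R}.

Definition tuple_cons (p : T * n.-tuple T) : n.+1.-tuple T :=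
  [tuple of p.1 :: p.2].

Lemma measurable_tuple_cons : measurable_fun setT tuple_cons.
Proof. exact: measurable_cons. Qed.

Definition power_measure_step : set (n.+1.-tuple T) -> \bar R :=
  pushforward (m \x mu)%E tuple_cons.

HB.instance Definition _ := Measure.copy power_measure_step
  (@measure_function_pushforward__canonical__measure_function_Measure
     _ _ _ _ R (m \x mu)%E tuple_cons measurable_tuple_cons).

Let power_measure_step_sigma_finite : sigma_finite setT power_measure_step.
Proof.
have /sigma_finiteP[F [FT Fnd Foo]] := sigma_finiteT m.
have /sigma_finiteP[G [GT Gnd Goo]] := sigma_finiteT mu.
pose tl (v : n.+1.-tuple T) : n.-tuple T := [tuple of behead v].
exists (fun k => (fun v : n.+1.-tuple T => tnth v ord0) @^-1` F k
                 `&` tl @^-1` G k).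
  rewrite predeqE => v; split => // _.
  have [k _ Fk] : (\bigcup_i F i) (tnth v ord0) by rewrite -FT.
  have [l _ Gl] : (\bigcup_i G i) (tl v) by rewrite -GT.
  exists (maxn k l) => //; split.
    by have /subsetPset := Fnd _ _ (leq_maxl k l); exact.
  by have /subsetPset := Gnd _ _ (leq_maxr k l); exact.
move=> k; have [mF Fk] := Foo k; have [mG Gk] := Goo k; split.
  by apply: measurableI; rewrite -[X in measurable X]setTI;
    [exact: measurable_tnth|exact: measurable_behead].
rewrite /power_measure_step /pushforward.
rewrite (_ : _ @^-1` _ = F k `*` G k).
  by rewrite product_measure1E// lte_mul_pinfty// ge0_fin_numE.
apply/seteqP; split => -[x v]; rewrite /tl/=.
  by case=> Fx; rewrite (_ : [tuple of _] = v)//; exact: val_inj.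
by case=> Fx Gv; split => //; rewrite (_ : [tuple of _] = v)//; exact: val_inj.
Qed.

HB.instance Definition _ := Measure_isSigmaFinite.Build _ _ _
  power_measure_step power_measure_step_sigma_finite.
End power_measure_step.

Fixpoint power_measure d (T : measurableType d) (R : realType)
    (m : {sigma_finite_measure set T -> \bar R}) (n : nat) :
    {sigma_finite_measure set (n.-tuple T) -> \bar R} :=
  match n with
  | 0 => dirac [tuple]
  | k.+1 => power_measure_step m (power_measure m k)
  end.

Definition lebesgue_tuple (R : realType) (n : nat) :
    {sigma_finite_measure set (n.-tuple (measurableTypeR R)) -> \bar R} :=
  power_measure (@lebesgue_measure R) n.

Section generalized_functions.
Context {R : realType} {n : nat}.
Local Notation C := (R[i]).
Local Notation Rn := ('rV[R]_n).
Implicit Types (f g phi : Rn -> C) (x y : Rn) (K L U V Omega : set Rn).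

Definition unit_vec (i : 'I_n) : Rn := delta_mx 0 i.

Definition partials (s : seq 'I_n) (f : Rn -> R) : Rn -> R :=
  foldr (fun i h => 'D_(unit_vec i) h) f s.

(* For [V] open, this only depends on the restriction of [f] to [V]. *)
Definition smooth_on V (f : Rn -> R) : Prop :=
  forall (s : seq 'I_n) x, V x ->
    {for x, continuous (partials s f)} /\
    forall i, derivable (partials s f) x (unit_vec i).

(* Smooth functions on an open set [V] are represented by functions on the whole
   of R^n, whose values outside [V] are irrelevant. *)
Definition csmooth_on V f : Prop :=
  smooth_on V (fun x => complex.Re (f x)) /\
  smooth_on V (fun x => complex.Im (f x)).

Definition multiindex := {ffun 'I_n -> nat}.
Definition mdeg (al : multiindex) : nat := (\sum_i al i)%N.
Definition mseq (al : multiindex) : seq 'I_n :=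
  flatten [seq nseq (al i) i | i <- enum 'I_n].

Definition cpartial (al : multiindex) f x : C :=
  (partials (mseq al) (fun t => complex.Re (f t)) x +i*
   partials (mseq al) (fun t => complex.Im (f t)) x)%C.

Definition cintegral f : C :=
  (Rintegral (lebesgue_tuple R n) setT
     (fun t => complex.Re (f (\row_i tnth t i))) +i*
   Rintegral (lebesgue_tuple R n) setT
     (fun t => complex.Im (f (\row_i tnth t i))))%C.

(* Supremum in [0, +oo] of a set of nonnegative reals; it is 0 on the empty set. *)
Definition sup_nneg (A : set R) : \bar R :=
  ereal_sup ([set 0%E] `|` [set r%:E | r in A]).

Definition seminorm K (m : nat) f : \bar R :=
  sup_nneg [set r | exists x (al : multiindex),
    [/\ K x, (mdeg al <= m)%N & r = Normc.normc (cpartial al f x)]].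

Definition test_norm (c : nat) phi : \bar R := seminorm setT c phi.

Definition supp phi : set Rn := closure [set x | phi x != 0].

Definition test_functions : set (Rn -> C) :=
  [set phi | csmooth_on setT phi /\ compact (supp phi)].

Definition compactly_in K L : Prop := compact K /\ K `<=` L°.

Definition sumset K L : set Rn := [set x + y | x in K & y in L].

(* ||phi^star - delta||_{K,c;B}. If B consists of functions on U and
   x + supp phi is contained in U for all x in K, the integrand vanishes outside
   U and the values of the elements of B outside U do not matter. *)
Definition delta_dist K (c : nat) (B : set (Rn -> C)) phi : \bar R :=
  sup_nneg [set r | exists x (al : multiindex) f,
    [/\ K x, (mdeg al <= c)%N, B f &
      r = Normc.normc
        (cintegral (fun y => f y * cpartial al (fun t => phi (y - t)) x)
         - cpartial al f x)]].

Definition Cinfty_bounded U (B : set (Rn -> C)) : Prop :=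
  (forall f, B f -> csmooth_on U f) /\
  (forall K (m : nat), compact K -> K `<=` U ->
     exists M : R, forall f, B f -> (seminorm K m f <= M%:E)%E).

Definition UOmega Omega : set ((Rn -> C) * Rn) :=
  [set p | [/\ test_functions p.1, Omega p.2 &
              sumset [set p.2] (supp p.1) `<=` Omega]].

(* [x |-> R (phi, x)], extended by 0 to the points where it is not defined. *)
Definition slice Omega (F : UOmega Omega -> C) phi : Rn -> C :=
  fun x => oapp F 0 (insub (phi, x)).

Definition basic_elements Omega : set (UOmega Omega -> C) :=
  [set F | forall phi, test_functions phi ->
     csmooth_on [set x | UOmega Omega (phi, x)] (slice F phi)].

Definition nneg_poly (lam : {poly R}) : Prop := forall i, 0 <= lam`_i.

(* In [{poly {poly R}}] the inner variable is y_0 and the outer one is z_0: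
   [lam.[0]] is lambda(y_0, 0) and [lam.[z%:P].[y]] is lambda(y, z). *)
Definition nneg_poly_I (lam : {poly {poly R}}) : Prop :=
  (forall i j, 0 <= lam`_i`_j) /\ lam.[0] = 0.

Definition nbhd_in Omega x U : Prop := [/\ open U, U x & U `<=` Omega].

(* In the next two definitions the norms passed to [fine] are always finite: phi
   is a test function, and in the second one B is bounded, K is compact and
   K + supp phi is contained in the compact subset L of U. *)
Definition moderate_elements Omega : set (UOmega Omega -> C) :=
  [set F | basic_elements F /\
    forall x, Omega x -> exists2 U, nbhd_in Omega x U &
    forall K L, compactly_in K U -> compactly_in L U -> compactly_in K L ->
    forall m : nat, exists (c : nat) (lam : {poly R}), nneg_poly lam /\
    forall phi, test_functions phi -> sumset K (supp phi) `<=` L ->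
      (seminorm K m (slice F phi) <= (lam.[fine (test_norm c phi)])%:E)%E].

Definition negligible_elements Omega : set (UOmega Omega -> C) :=
  [set F | basic_elements F /\
    forall x, Omega x -> exists2 U, nbhd_in Omega x U &
    forall K L, compactly_in K U -> compactly_in L U -> compactly_in K L ->
    forall m : nat, exists (c : nat) (lam : {poly {poly R}}) (B : set (Rn -> C)),
    [/\ nneg_poly_I lam, Cinfty_bounded U B &
    forall phi, test_functions phi -> sumset K (supp phi) `<=` L ->
      (seminorm K m (slice F phi) <=
       (lam.[(fine (delta_dist K c B phi))%:P].[fine (test_norm c phi)])%:E)%E]].

End generalized_functions.

Arguments UOmega {R n} Omega.
Arguments basic_elements {R n} Omega.
Arguments moderate_elements {R n} Omega.
Arguments negligible_elements {R n} Omega.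

(* Pointwise operations on complex functions on a set [T]. The library's
   [lalgType] requires 1 != 0, which fails for [T -> R[i]] when [T] is empty. *)
Section algebra.
Context {R : realType} {T : Type}.
Implicit Types A M N : set (T -> R[i]).

Definition is_subalgebra A M : Prop :=
  [/\ M `<=` A,
      M (cst 1),
      forall F G, M F -> M G -> M (F + G),
      forall (k : R[i]) F, M F -> M (cst k * F) &
      forall F G, M F -> M G -> M (F * G)].

Definition is_ideal M N : Prop :=
  [/\ N `<=` M,
      N (cst 0),
      forall F G, N F -> N G -> N (F + G),
      forall (k : R[i]) F, N F -> N (cst k * F) &
      forall F G, M F -> N G -> N (F * G)].

End algebra.

(* Main.v *)
Require Import Defs.
From mathcomp Require Import all_boot all_order all_algebra.
From mathcomp Require Import all_classical all_reals all_analysis.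
From mathcomp Require Import complex.
From mathcomp Require Import ring.
Import numFieldNormedType.Exports.
Local Open Scope classical_set_scope.
Local Open Scope ring_scope.
Import Order.TTheory GRing.Theory Num.Theory.
Set Implicit Arguments.
Unset Strict Implicit.
Unset Printing Implicit Defensive.

(** Three facts carry the proof.

    First, the slices of a basic element are smooth on an open set ([open_slice_dom])
    that contains the compact set [K] of every estimate ([sub_slice_dom]). The
    Leibniz rule on that open set ([partialsM]) gives
    [seminorm K m (f * g) <= 2 ^ (m + 2) * seminorm K m f * seminorm K m g]
    ([seminormM]), along with subadditivity ([seminormD]).

    Second, the estimates that define moderate and negligible elements are stable
    under intersection of the neighborhoods [U], and they get weaker when the order
    [c] and the bounded set [B] grow, because the coefficients of the polynomials are
    nonnegative. So two elements can be estimated over the same [U], [c] and [B], and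
    the polynomials are then added or multiplied. A factor that vanishes at
    [z_0 = 0] makes the product vanish there, which gives the ideal property.

    Third, [delta_dist K c B phi <= a * test_norm c phi + b] with [a] and [b]
    independent of [phi] ([delta_dist_bound]). Substituting this affine bound for
    [z_0] turns the estimate of a negligible element into that of a moderate one
    ([negligible_moderate]). It also shows that the distance is finite; together
    with the finiteness of the test norms ([test_norm_fin]) this is what makes the
    comparison of orders and bounded sets survive the passage from extended reals to
    reals. *)

(** * Iterated partial derivatives of real functions *)

Section partial_derivatives.
Context {R : realType} {n : nat}.
Local Notation Rn := ('rV[R]_n).
Implicit Types (f g : Rn -> R) (x y v : Rn) (V : set Rn) (s : seq 'I_n).

(** Locality of the derivatives on an open set. A slice of a basic element is
    only meaningful on an open set, so this is what gives sense to its seminorms. *)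
Lemma partials_eq_on V f g s x : open V -> (forall y, V y -> f y = g y) ->
  V x -> partials s f x = partials s g x.
Proof.
move=> oV fg; elim: s x => [|i s IH] x Vx /=; first exact: fg.
apply: near_eq_derive; near=> y; apply: IH; near: y.
exact: open_nbhs_nbhs.
Unshelve. all: by end_near. Qed.

(** Smoothness is checked on any formula for the iterated partial derivatives;
    the closure properties below differ only in that formula. *)
Lemma smooth_on_partials_eq V f (F : seq 'I_n -> Rn -> R) : open V ->
  (forall s y, V y -> partials s f y = F s y) ->
  (forall s y, V y -> {for y, continuous (F s)} /\
     forall i, derivable (F s) y (unit_vec i)) ->
  smooth_on V f.
Proof.
move=> oV fF sF s x Vx; have [cF dF] := sF s x Vx.
have E : {near x, F s =1 partials s f}.
  near=> y; rewrite fF//; near: y; exact: open_nbhs_nbhs.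
split=> [|i]; last exact: near_eq_derivable E (dF i).
rewrite /prop_for /continuous_at -(nbhs_singleton E).
exact: cvg_trans (near_eq_cvg E) cF.
Unshelve. all: by end_near. Qed.

Lemma smooth_on_eq V f g : open V -> (forall y, V y -> f y = g y) ->
  smooth_on V f -> smooth_on V g.
Proof.
move=> oV fg sf; apply: (smooth_on_partials_eq (F := partials^~ f)) => // s y Vy.
by apply/esym; exact: partials_eq_on oV fg Vy.
Qed.

Lemma partials_cst s (a : R) :
  partials s (cst a : Rn -> R) = cst (if s is [::] then a else 0).
Proof.
elim: s => [//|i s IH] /=; apply/funext => x; by rewrite IH derive_cst.
Qed.

Lemma smooth_on_cst V (a : R) : smooth_on V (cst a).
Proof.
move=> s x _; rewrite partials_cst.
by split=> [|i]; [exact: cst_continuous | exact: derivable_cst].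
Qed.

Lemma is_derive_partials V f s i x : smooth_on V f -> V x ->
  is_derive x (unit_vec i) (partials s f) (partials (i :: s) f x).
Proof. by move=> sf Vx; apply: DeriveDef => //; case: (sf s x Vx). Qed.

Lemma partialsD V f g s x : open V -> smooth_on V f -> smooth_on V g -> V x ->
  partials s (fun y => f y + g y) x = partials s f x + partials s g x.
Proof.
move=> oV sf sg; elim: s x => [//|i s IH] x Vx.
have E : {near x, partials s f + partials s g =1 partials s (fun y => f y + g y)}.
  near=> y; rewrite IH//; near: y; exact: open_nbhs_nbhs.
have df := is_derive_partials s i sf Vx.
have dg := is_derive_partials s i sg Vx.
exact: (@derive_val _ _ _ _ _ _ _ (near_eq_is_derive E (is_deriveD df dg))).
Unshelve. all: by end_near. Qed.

Lemma smooth_onD V f g : open V -> smooth_on V f -> smooth_on V g ->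
  smooth_on V (fun y => f y + g y).
Proof.
move=> oV sf sg.
apply: (smooth_on_partials_eq (F := fun s => partials s f + partials s g)) => //.
  by move=> s y Vy; rewrite (partialsD _ oV).
move=> s y Vy; have [cf df] := sf s y Vy; have [cg dg] := sg s y Vy.
by split=> [|i]; [exact: (cvgD cf cg) | exact: derivableD].
Qed.

Lemma partialsN V f s x : open V -> smooth_on V f -> V x ->
  partials s (fun y => - f y) x = - partials s f x.
Proof.
move=> oV sf; elim: s x => [//|i s IH] x Vx.
have E : {near x, - partials s f =1 partials s (fun y => - f y)}.
  near=> y; rewrite IH//; near: y; exact: open_nbhs_nbhs.
have df := is_derive_partials s i sf Vx.
exact: (@derive_val _ _ _ _ _ _ _ (near_eq_is_derive E (is_deriveN df))).
Unshelve. all: by end_near. Qed.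

Lemma smooth_onN V f : open V -> smooth_on V f -> smooth_on V (fun y => - f y).
Proof.
move=> oV sf; apply: (smooth_on_partials_eq (F := fun s => - partials s f)) => //.
  by move=> s y Vy; rewrite (partialsN _ oV).
move=> s y Vy; have [cf df] := sf s y Vy.
by split=> [|i]; [exact: (cvgN cf) | exact: derivableN].
Qed.

(** The ways of letting each derivative of [s] act on one of two factors. The
    order of the derivatives is kept, so both components are subsequences. *)
Fixpoint splits s : seq (seq 'I_n * seq 'I_n) :=
  if s is i :: s' then
    [seq (i :: p.1, p.2) | p <- splits s'] ++
    [seq (p.1, i :: p.2) | p <- splits s']
  else [:: ([::], [::])].

Lemma size_splits s : size (splits s) = (2 ^ size s)%N.
Proof.
by elim: s => //= i s IH; rewrite size_cat !size_map IH expnS mul2n addnn.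
Qed.

Lemma splits_subseq s p : p \in splits s -> subseq p.1 s /\ subseq p.2 s.
Proof.
elim: s p => [|i s IH] p /=; first by rewrite inE => /eqP ->.
rewrite mem_cat => /orP[] /mapP[q /IH[q1 q2] ->] /=; rewrite eqxx; split => //;
  exact: subseq_trans (subseq_cons _ _).
Qed.

Definition leibniz f g s : Rn -> R :=
  fun x => \sum_(p <- splits s) partials p.1 f x * partials p.2 g x.

(** A new derivative acts on the first or on the second factor of each term:
    these are the two halves of [splits (i :: s)]. *)
Lemma is_derive_leibniz V f g i s x : smooth_on V f -> smooth_on V g -> V x ->
  is_derive x (unit_vec i) (leibniz f g s) (leibniz f g (i :: s) x).
Proof.
move=> sf sg Vx; rewrite /leibniz /= big_cat/= !big_map/= -big_split/=.
elim: (splits s) => [|p l IH].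
  rewrite big_nil (_ : (fun=> _) = cst 0); first exact: is_derive_cst.
  by apply/funext => y; rewrite big_nil.
rewrite big_cons (_ : (fun=> _) = partials p.1 f * partials p.2 g +
  (fun y => \sum_(p <- l) partials p.1 f y * partials p.2 g y)); last first.
  by apply/funext => y; rewrite big_cons.
apply: is_deriveD; rewrite addrC [X in _ + X]mulrC.
by apply: is_deriveM; exact: is_derive_partials Vx.
Qed.

Lemma partialsM V f g s x : open V -> smooth_on V f -> smooth_on V g -> V x ->
  partials s (fun y => f y * g y) x = leibniz f g s x.
Proof.
move=> oV sf sg; elim: s x => [|i s IH] x Vx.
  by rewrite /leibniz /= big_seq1.
have E : {near x, leibniz f g s =1 partials s (fun y => f y * g y)}.
  near=> y; rewrite IH//; near: y; exact: open_nbhs_nbhs.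
exact: (@derive_val _ _ _ _ _ _ _ (near_eq_is_derive E
  (is_derive_leibniz i s sf sg Vx))).
Unshelve. all: by end_near. Qed.

Lemma smooth_onM V f g : open V -> smooth_on V f -> smooth_on V g ->
  smooth_on V (fun y => f y * g y).
Proof.
move=> oV sf sg; apply: (smooth_on_partials_eq (F := leibniz f g)) => //.
  by move=> s y; exact: partialsM.
move=> s y Vy; split=> [|i]; last first.
  exact: (@ex_derive _ _ _ _ _ _ _ (is_derive_leibniz i s sf sg Vy)).
rewrite /leibniz; elim: (splits s) => [|p l IH].
  rewrite (_ : (fun=> _) = cst 0); first exact: cst_continuous.
  by apply/funext => z; rewrite big_nil.
rewrite (_ : (fun=> _) = partials p.1 f * partials p.2 g +
  (fun y => \sum_(p <- l) partials p.1 f y * partials p.2 g y)); last first.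
  by apply/funext => z; rewrite big_cons.
exact: (cvgD (cvgM (sf p.1 _ Vy).1 (sg p.2 _ Vy).1) IH).
Qed.

(** There are [2 ^ size s] terms in the Leibniz formula. *)
Lemma partialsM_le V f g s x (a b : R) :
  open V -> smooth_on V f -> smooth_on V g -> V x ->
  (forall t, subseq t s -> `|partials t f x| <= a) ->
  (forall t, subseq t s -> `|partials t g x| <= b) ->
  `|partials s (fun y => f y * g y) x| <= (2 ^ size s)%:R * (a * b).
Proof.
move=> oV sf sg Vx fa gb; rewrite (partialsM _ oV)// /leibniz.
apply: (le_trans (ler_norm_sum _ _ _)).
have -> : (2 ^ size s)%:R * (a * b) = \sum_(p <- splits s) a * b.
  by rewrite big_const_seq count_predT iter_addr_0 size_splits mulr_natl.
rewrite big_seq [leRHS]big_seq.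
by apply: ler_sum => p /splits_subseq[p1 p2]; rewrite normrM ler_pM ?fa ?gb.
Qed.

(** The growth rate of [t |-> f (y - t)] at [h] is the opposite of the growth rate
    of [f] at [- h], so no chain rule is involved. *)
Lemma is_derive_reflect f x y v : derivable f (y - x) v ->
  is_derive x v (fun t => f (y - t)) (- 'D_v f (y - x)).
Proof.
move=> df.
have cN : -%R h @[h --> 0^'] --> (0 : R)^'.
  rewrite -[X in _ --> X^']oppr0; apply: continuous_injective_withinNx.
    exact: opp_continuous.
  by move=> z /oppr_inj.
pose q (h : R) : R := h^-1 *: ((f \o shift (y - x)) (h *: v) - f (y - x)).
have E : (fun h : R => h^-1 *: (((fun t => f (y - t)) \o shift x) (h *: v) -
    f (y - x))) = - (q \o -%R).
  apply/funext => h; rewrite /q/= fctE/= invrN scaleNr opprK scaleNr.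
  by rewrite opprD addrCA.
have D : (fun h : R => h^-1 *: (((fun t => f (y - t)) \o shift x) (h *: v) -
    f (y - x))) h @[h --> 0^'] --> - 'D_v f (y - x).
  rewrite E; have dq : q h @[h --> 0^'] --> 'D_v f (y - x) by exact: df.
  have cq : (q \o -%R) h @[h --> 0^'] --> 'D_v f (y - x) :=
    cvg_comp _ _ cN dq.
  exact: cvgN cq.
by apply: DeriveDef; [apply/cvg_ex; exists (- 'D_v f (y - x)) | exact: cvg_lim].
Qed.

Lemma partials_reflect f y s : smooth_on setT f ->
  partials s (fun t => f (y - t)) =
  fun x => (-1) ^+ size s * partials s f (y - x).
Proof.
move=> sf; elim: s => [|i s IH]; first by apply/funext => x; rewrite mul1r.
apply/funext => x; rewrite /= IH.
have [_ df] := sf s (y - x) I.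
have /(is_deriveZ ((-1) ^+ size s))/@derive_val := is_derive_reflect (df i).
by move=> ->; rewrite exprS mulN1r mulNr -mulrN.
Qed.

End partial_derivatives.

(** * Multiindices and seminorms *)

Section multiindices.
Context {n : nat}.
Implicit Types (s t : seq 'I_n) (al be : @multiindex n).

Lemma size_mseq al : size (mseq al) = mdeg al.
Proof.
rewrite /mseq size_flatten /shape -map_comp sumnE big_map big_enum/=.
by apply: eq_bigr => i _; rewrite size_nseq.
Qed.

Lemma subseq_cat_split s s1 s2 : subseq s (s1 ++ s2) ->
  exists t1 t2, [/\ s = t1 ++ t2, subseq t1 s1 & subseq t2 s2].
Proof.
move=> /subseqP[m sm ->]; exists (mask (take (size s1) m) s1).
exists (mask (drop (size s1) m) s2); split; rewrite ?mask_subseq//.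
rewrite -mask_cat ?cat_take_drop//.
by rewrite size_takel// sm size_cat leq_addr.
Qed.

(** [mseq al] lists its entries in increasing order, so a subsequence is again the
    sorted list of a multiindex. The derivatives in the Leibniz formula are
    therefore among those that the seminorms control, and it is never
    necessary to exchange two derivatives. *)
Lemma subseq_mseq al t : subseq t (mseq al) ->
  exists2 be, t = mseq be & (mdeg be <= mdeg al)%N.
Proof.
move=> tal; pose be : @multiindex n := [ffun i => count_mem i t].
suff tbe : t = mseq be.
  by exists be => //; rewrite -!size_mseq -tbe size_subseq.
rewrite /mseq (eq_map (g := fun i => nseq (count_mem i t) i)); last first.
  by move=> i; rewrite ffunE.
move: tal; rewrite /mseq {be}; have := enum_uniq 'I_n.
elim: (enum 'I_n) t => [|i e IH] t /=; first by case: t.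
case/andP=> ie ue /subseq_cat_split[t1 [t2 [-> st1 st2]]].
have t1E : t1 = nseq (size t1) i.
  apply/all_pred1P/allP => j /(mem_subseq st1).
  by rewrite mem_nseq => /andP[].
have it2 : count_mem i t2 = 0%N.
  apply/count_memPn/negP => /(mem_subseq st2)/flatten_mapP[j je].
  by rewrite mem_nseq => /andP[_ /eqP ij]; rewrite ij je in ie.
rewrite count_cat it2 addn0 {2}t1E count_nseq/= eqxx mul1n -t1E.
congr cat; rewrite {1}(IH t2)//; congr flatten.
apply/eq_in_map => j je; rewrite count_cat t1E count_nseq/=.
by case: eqP => [ij|_]; [rewrite ij je in ie | rewrite mul0n].
Qed.

End multiindices.

Section seminorms.
Context {R : realType} {n : nat}.
Local Notation C := R[i].
Local Notation Rn := 'rV[R]_n.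
Implicit Types (f g phi : Rn -> C) (x y : Rn) (K L U V : set Rn).
Implicit Types (al be : @multiindex n) (s : seq 'I_n).

(** The element 0 adjoined in [sup_nneg] is harmless below a nonnegative bound. *)
Lemma sup_nneg_leP (A : set R) (M : R) : 0 <= M ->
  (sup_nneg A <= M%:E)%E <-> (forall r, A r -> r <= M).
Proof.
move=> M0; split=> [AM r Ar|AM].
  by rewrite -lee_fin (le_trans _ AM)//; apply: ereal_sup_ubound; right; exists r.
by apply: ge_ereal_sup => _ [->|[r Ar <-]]; rewrite lee_fin//; exact: AM.
Qed.

Lemma sup_nneg_ge0 (A : set R) : (0 <= sup_nneg A)%E.
Proof. by apply: ereal_sup_ubound; left. Qed.

Lemma sup_nneg_le (A : set R) (M : R) : (sup_nneg A <= M%:E)%E ->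
  0 <= M /\ forall r, A r -> r <= M.
Proof.
move=> AM; have M0 : 0 <= M by rewrite -lee_fin (le_trans (sup_nneg_ge0 A)).
by split=> //; apply/(sup_nneg_leP _ M0).
Qed.

Lemma le_sup_nneg (A B : set R) : A `<=` B -> (sup_nneg A <= sup_nneg B)%E.
Proof. by move=> AB; apply: ereal_sup_le; apply: setUS; apply: image_subset. Qed.

Lemma normc_le_sum (z : C) :
  Normc.normc z <= `|complex.Re z| + `|complex.Im z|.
Proof.
case: z => a b /=; rewrite -[leRHS]ger0_norm ?addr_ge0// -sqrtr_sqr.
rewrite ler_wsqrtr// sqrrD !real_normK ?num_real// -addrA lerD2l lerDr.
by rewrite mulrn_wge0 ?mulr_ge0.
Qed.

Lemma Re_le_normc (z : C) : `|complex.Re z| <= Normc.normc z.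
Proof. by case: z => a b /=; rewrite -sqrtr_sqr ler_wsqrtr// lerDl sqr_ge0. Qed.

Lemma normc_ge0 (z : C) : 0 <= Normc.normc z.
Proof. exact: le_trans (normr_ge0 _) (Re_le_normc z). Qed.

Lemma Im_le_normc (z : C) : `|complex.Im z| <= Normc.normc z.
Proof. by case: z => a b /=; rewrite -sqrtr_sqr ler_wsqrtr// lerDr sqr_ge0. Qed.

Lemma seminormP K m f (M : R) : 0 <= M ->
  (seminorm K m f <= M%:E)%E <->
  (forall x al, K x -> (mdeg al <= m)%N -> Normc.normc (cpartial al f x) <= M).
Proof.
move=> M0; split=> [/(sup_nneg_leP _ M0) fM x al Kx am|fM].
  by apply: fM; exists x, al.
by apply/(sup_nneg_leP _ M0) => _ [x [al [Kx am ->]]]; exact: fM.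
Qed.

Lemma seminorm_le0 K m f (M : R) : (seminorm K m f <= M%:E)%E -> 0 <= M.
Proof. by case/sup_nneg_le. Qed.

Lemma seminorm_partials K m f (M : R) x al s : (seminorm K m f <= M%:E)%E ->
  K x -> (mdeg al <= m)%N -> subseq s (mseq al) ->
  `|partials s (fun t => complex.Re (f t)) x| <= M /\
  `|partials s (fun t => complex.Im (f t)) x| <= M.
Proof.
move=> fM Kx am /subseq_mseq[be -> bea]; have M0 := seminorm_le0 fM.
have := (seminormP K m f M0).1 fM x be Kx (leq_trans bea am).
by move=> H; split; apply: le_trans H; [exact: (Re_le_normc (cpartial be f x))|
  exact: (Im_le_normc (cpartial be f x))].
Qed.

Lemma csmooth_on_eq V f g : open V -> (forall y, V y -> f y = g y) ->
  csmooth_on V f -> csmooth_on V g.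
Proof.
by move=> oV fg [sr si]; split; [apply: smooth_on_eq sr | apply: smooth_on_eq si]
  => // y Vy; rewrite fg.
Qed.

Lemma csmooth_on_cst V (k : C) : csmooth_on V (cst k).
Proof. by split; exact: smooth_on_cst. Qed.

Lemma csmooth_onD V f g : open V -> csmooth_on V f -> csmooth_on V g ->
  csmooth_on V (fun y => f y + g y).
Proof.
move=> oV [fr fi] [gr gi]; split.
  apply: (smooth_on_eq oV _ (smooth_onD oV fr gr)) => y _ /=.
  by case: (f y) (g y) => ? ? [].
apply: (smooth_on_eq oV _ (smooth_onD oV fi gi)) => y _ /=.
by case: (f y) (g y) => ? ? [].
Qed.

Let Re_mulE f g y : complex.Re (f y * g y) =
  complex.Re (f y) * complex.Re (g y) +
  - (complex.Im (f y) * complex.Im (g y)).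
Proof. by case: (f y) (g y) => ? ? [? ?]. Qed.

Let Im_mulE f g y : complex.Im (f y * g y) =
  complex.Re (f y) * complex.Im (g y) + complex.Im (f y) * complex.Re (g y).
Proof. by case: (f y) (g y) => ? ? [? ?] /=. Qed.

Lemma csmooth_onM V f g : open V -> csmooth_on V f -> csmooth_on V g ->
  csmooth_on V (fun y => f y * g y).
Proof.
move=> oV [fr fi] [gr gi].
split.
  apply: (smooth_on_eq oV _ (smooth_onD oV (smooth_onM oV fr gr)
    (smooth_onN oV (smooth_onM oV fi gi)))) => y _.
  by rewrite Re_mulE.
apply: (smooth_on_eq oV _ (smooth_onD oV (smooth_onM oV fr gi)
  (smooth_onM oV fi gr))) => y _.
by rewrite Im_mulE.
Qed.

Lemma seminorm_eq_on K m V f g : open V -> K `<=` V ->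
  (forall y, V y -> f y = g y) -> seminorm K m f = seminorm K m g.
Proof.
move=> oV KV fg.
have E x al : K x -> cpartial al f x = cpartial al g x.
  move=> /KV Vx; rewrite /cpartial.
  by congr (_ +i* _)%C; apply: (partials_eq_on _ oV) Vx => y Vy; rewrite fg.
congr sup_nneg; apply/seteqP.
by split=> r [x [al [Kx am ->]]]; exists x, al; rewrite E.
Qed.

Lemma seminormD K m V f g (a b : R) : open V -> K `<=` V ->
  csmooth_on V f -> csmooth_on V g ->
  (seminorm K m f <= a%:E)%E -> (seminorm K m g <= b%:E)%E ->
  (seminorm K m (fun y => f y + g y)%R <= (a + b)%R%:E)%E.
Proof.
move=> oV KV [fr fi] [gr gi] fa gb.
have a0 := seminorm_le0 fa; have b0 := seminorm_le0 gb.
apply/seminormP => [|x al Kx am]; first exact: addr_ge0.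
have -> : cpartial al (fun y => f y + g y) x = cpartial al f x + cpartial al g x.
  have Vx := KV _ Kx; rewrite /cpartial; apply/eqP; rewrite eq_complex/=.
  rewrite -(partialsD _ oV fr gr Vx) -(partialsD _ oV fi gi Vx).
  by apply/andP; split; apply/eqP; congr (partials _ _ x); apply/funext => y;
    case: (f y) (g y) => ? ? [].
apply: le_trans (le_normcD _ _) _.
by apply: lerD; [exact: (seminormP _ _ _ a0).1 fa _ _ Kx am |
  exact: (seminormP _ _ _ b0).1 gb _ _ Kx am].
Qed.

(** Each of the real and imaginary parts of a product is a sum of two products of
    real functions, and each of these four obeys the Leibniz bound with 2 ^ m terms:
    hence the exponent m + 2. *)
Lemma seminormM K m V f g (a b : R) : open V -> K `<=` V ->
  csmooth_on V f -> csmooth_on V g ->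
  (seminorm K m f <= a%:E)%E -> (seminorm K m g <= b%:E)%E ->
  (seminorm K m (fun y => f y * g y)%R <= ((2 ^ m.+2)%:R * (a * b))%R%:E)%E.
Proof.
move=> oV KV [fr fi] [gr gi] fa gb.
have a0 := seminorm_le0 fa; have b0 := seminorm_le0 gb.
have ab0 : 0 <= a * b by exact: mulr_ge0.
apply/seminormP => [|x al Kx am]; first exact: mulr_ge0.
have Vx := KV _ Kx.
have bound (u v : Rn -> R) : smooth_on V u -> smooth_on V v ->
    (forall s, subseq s (mseq al) -> `|partials s u x| <= a) ->
    (forall s, subseq s (mseq al) -> `|partials s v x| <= b) ->
    `|partials (mseq al) (fun y => u y * v y) x| <= (2 ^ m)%:R * (a * b).
  move=> su sv ua vb; apply: le_trans (partialsM_le oV su sv Vx ua vb) _.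
  by rewrite ler_wpM2r// ler_nat leq_pexp2l// size_mseq.
have fB s (h : subseq s (mseq al)) := seminorm_partials fa Kx am h.
have gB s (h : subseq s (mseq al)) := seminorm_partials gb Kx am h.
have sM := smooth_onM oV.
apply: le_trans (normc_le_sum _) _ => /=.
rewrite (eq_fun (Re_mulE f g)) (eq_fun (Im_mulE f g)).
rewrite !(partialsD _ oV _ _ Vx) ?(partialsN _ oV _ Vx); do ?[exact: sM];
  last by apply: smooth_onN => //; exact: sM.
have -> : (2 ^ m.+2)%:R * (a * b) = ((2 ^ m)%:R * (a * b) + (2 ^ m)%:R * (a * b)) +
  ((2 ^ m)%:R * (a * b) + (2 ^ m)%:R * (a * b)) :> R.
  by rewrite !expnS !natrM; ring.
by apply: lerD; apply: (le_trans (ler_normD _ _)); apply: lerD; rewrite ?normrN;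
  apply: bound => // s h; case: (fB s h); case: (gB s h).
Qed.

Lemma le_seminorm K m m' f : (m <= m')%N -> (seminorm K m f <= seminorm K m' f)%E.
Proof.
move=> mm; apply: le_sup_nneg => r [x [al [Kx am ->]]].
by exists x, al; rewrite (leq_trans am).
Qed.

Lemma le_delta_dist K c c' (B B' : set (Rn -> C)) phi : (c <= c')%N ->
  B `<=` B' -> (delta_dist K c B phi <= delta_dist K c' B' phi)%E.
Proof.
move=> cc BB; apply: le_sup_nneg => r [x [al [f [Kx am Bf ->]]]].
by exists x, al, f; rewrite (leq_trans am) //; split=> //; exact: BB.
Qed.

End seminorms.

(** * Polynomials with nonnegative coefficients, integrals and boxes *)

Section polynomials.
Context {R : realType}.
Implicit Types (p q : {poly R}) (lam : {poly {poly R}}) (x y z : R).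

Lemma nneg_polyC x : 0 <= x -> nneg_poly x%:P.
Proof. by move=> x0 i; rewrite coefC; case: ifP. Qed.

Lemma nneg_polyD p q : nneg_poly p -> nneg_poly q -> nneg_poly (p + q).
Proof. by move=> p0 q0 i; rewrite coefD addr_ge0. Qed.

Lemma nneg_polyM p q : nneg_poly p -> nneg_poly q -> nneg_poly (p * q).
Proof. by move=> p0 q0 i; rewrite coefM sumr_ge0// => j _; rewrite mulr_ge0. Qed.

Lemma nneg_horner_ge0 p x : nneg_poly p -> 0 <= x -> 0 <= p.[x].
Proof.
move=> p0 x0; rewrite horner_coef sumr_ge0// => i _.
by rewrite mulr_ge0 ?exprn_ge0.
Qed.

Lemma nneg_horner_le p x y : nneg_poly p -> 0 <= x -> x <= y -> p.[x] <= p.[y].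
Proof.
move=> p0 x0 xy; rewrite !horner_coef ler_sum// => i _.
by rewrite ler_wpM2l// lerXn2r ?nnegrE// (le_trans x0).
Qed.

Lemma nneg_poly_horner lam p : (forall i, nneg_poly lam`_i) -> nneg_poly p ->
  nneg_poly lam.[p].
Proof.
move=> l0 p0; rewrite horner_coef.
elim/big_ind: _ => [i||i _]; [by rewrite coef0 | exact: nneg_polyD |].
apply: nneg_polyM => //; elim: (nat_of_ord i) => [|k IH].
  by rewrite expr0; apply: nneg_polyC.
by rewrite exprS; apply: nneg_polyM.
Qed.

(** Reading both [lam.[p].[y]] and [lam.[z%:P].[y]] as sums of the same shape: only
    the value of the inner polynomial at [y] matters. *)
Lemma horner_horner lam p y :
  lam.[p].[y] = \sum_(i < size lam) (lam`_i).[y] * p.[y] ^+ i.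
Proof.
rewrite (horner_coef lam) horner_sum; apply: eq_bigr => i _.
by rewrite hornerM horner_exp.
Qed.

Lemma nneg_horner2_le lam y y' z z' : (forall i, nneg_poly lam`_i) ->
  0 <= y -> y <= y' -> 0 <= z -> z <= z' ->
  lam.[z%:P].[y] <= lam.[z'%:P].[y'].
Proof.
move=> l0 y0 yy z0 zz; rewrite !horner_horner ler_sum// => i _; rewrite !hornerC.
apply: ler_pM; rewrite ?exprn_ge0 ?nneg_horner_ge0 ?nneg_horner_le//.
by rewrite lerXn2r ?nnegrE// (le_trans z0).
Qed.

End polynomials.

Section integral_bound.
Context d (T : measurableType d) (R : realType) (mu : {measure set T -> \bar R}).

(** Monotonicity holds without measurability, because the integral of a nonnegative
    function is a supremum over the simple functions below it. *)
Lemma le_integral_nneg (f g : T -> \bar R) : (forall x, 0 <= f x)%E ->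
  (forall x, f x <= g x)%E -> (\int[mu]_x f x <= \int[mu]_x g x)%E.
Proof.
move=> f0 fg; rewrite !ge0_integralTE//; last first.
  by move=> x; exact: le_trans (f0 x) (fg x).
apply: ereal_sup_le; apply: image_subset => h /= hf x.
exact: le_trans (hf x) (fg x).
Qed.

(** Bounds the pairing of a test function with a smooth function. The latter is
    only controlled on an open set, so the integrand is not known to be measurable;
    the positive and negative parts are compared with a multiple of the indicator
    of [A]. *)
Lemma Rintegral_bound (A : set T) (f : T -> R) (M : R) : measurable A ->
  (mu A < +oo)%E -> 0 <= M -> (forall x, A x -> `|f x| <= M) ->
  (forall x, ~ A x -> f x = 0) ->
  `|Rintegral mu setT f| <= M * fine (mu A).
Proof.
move=> mA Aoo M0 fM f0.
have muA : mu A \is a fin_num by rewrite ge0_fin_numE.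
have bound (g : T -> \bar R) : (forall x, 0 <= g x)%E ->
    (forall x, g x <= `|f x|%:E)%E ->
    exists2 r : R, (\int[mu]_x g x)%E = r%:E & 0 <= r <= M * fine (mu A).
  move=> g0 gf.
  have le : (\int[mu]_x g x <= (M * fine (mu A))%:E)%E.
    rewrite EFinM fineK// -integral_cst// (integral_mkcond A).
    apply: le_integral_nneg => // x.
    apply: le_trans (gf x) _.
    rewrite patchE; case: ifPn => [/set_mem/fM|/negP nA]; first by rewrite lee_fin.
    by rewrite f0 ?normr0// => /mem_set.
  have ge : (0 <= \int[mu]_x g x)%E by exact: integral_ge0.
  have fn : (\int[mu]_x g x)%E \is a fin_num.
    by rewrite ge0_fin_numE// (le_lt_trans le)// ltry.
  exists (fine (\int[mu]_x g x)); first by rewrite fineK.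
  by rewrite fine_ge0//= -lee_fin fineK.
have absE x : (`|f x|%:E = (EFin \o f)^\+ x + (EFin \o f)^\- x)%E.
  by have /(congr1 (@^~ x)) := fune_abse (EFin \o f).
have [|a aE /andP[a0 aM]] := bound _ (funepos_ge0 (EFin \o f)).
  by move=> x; rewrite absE leeDl.
have [|b bE /andP[b0 bM]] := bound _ (funeneg_ge0 (EFin \o f)).
  by move=> x; rewrite absE leeDr.
rewrite /Rintegral integralE aE bE -EFinB/=.
rewrite ler_norml; apply/andP; split.
  by rewrite lerNl opprB (le_trans _ bM)// gerBl.
by rewrite (le_trans _ aM)// gerBl.
Qed.
End integral_bound.

Section boxes.
Context {R : realType}.

Definition box (n : nat) (M : R) : set (n.-tuple (measurableTypeR R)) :=
  [set t | forall i, `|tnth t i| <= M].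

Arguments box : clear implicits.

Lemma measurable_box n M : measurable (box n M).
Proof.
rewrite (_ : box n M = \bigcap_(i in [set: 'I_n])
  ((fun t => tnth t i) @^-1` `[- M, M]%classic)); last first.
  apply/seteqP; split => t /= h i; last by have := h i I; rewrite /= in_itv/= ler_norml.
  by move=> _; rewrite /= in_itv/= -ler_norml.
apply: fin_bigcap_measurable => // i _.
by rewrite -[X in measurable X]setTI; exact: measurable_tnth.
Qed.

(** By induction on the dimension: a box is the product of an interval and a box. *)
Lemma lebesgue_box_lty n M : (lebesgue_tuple R n (box n M) < +oo)%E.
Proof.
elim: n => [|n IH].
  by rewrite /lebesgue_tuple/= diracE; case: (_ \in _); rewrite ltry.
rewrite /lebesgue_tuple/= /power_measure_step /pushforward.
rewrite (_ : _ @^-1` _ = `[- M, M]%classic `*` box n M); last first.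
  apply/seteqP; split => -[a t] /=.
    move=> h; split; first by have := h ord0; rewrite /= in_itv/= ler_norml.
    by move=> i; have := h (lift ord0 i); rewrite tnthS.
  move=> [/= aM tM] i; case: (unliftP ord0 i) => [j|] ->; first by rewrite tnthS.
  by rewrite /= ler_norml; move: aM; rewrite in_itv.
rewrite product_measure1E//; last exact: measurable_box.
have fin_itv : (lebesgue_measure `[(- M)%R, M]%classic < +oo)%E.
  by rewrite lebesgue_measure_itv/=; case: ifP => _; rewrite ltry.
by rewrite lte_mul_pinfty// ge0_fin_numE.
Qed.

End boxes.

(** * Norms of test functions and distance to the delta distribution *)

Section test_function_bounds.
Context {R : realType} {n : nat}.
Local Notation C := R[i].
Local Notation Rn := 'rV[R]_n.
Implicit Types (f g phi : Rn -> C) (x y : Rn) (K L U V S : set Rn).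
Implicit Types (al be : @multiindex n) (s : seq 'I_n).

Lemma supp_out phi x : ~ supp phi x -> phi x = 0.
Proof.
move=> nx; apply: contrapT => /eqP p0; apply: nx.
exact: (@subset_closure _ [set x | phi x != 0]).
Qed.

Lemma open_setC_supp phi : open (~` supp phi).
Proof. by apply: closed_openC; exact: closed_closure. Qed.

(** The complement of the support is an open set on which [phi] is constant. *)
Lemma cpartial_out_supp phi al x : ~ supp phi x -> cpartial al phi x = 0.
Proof.
move=> nx; rewrite /cpartial.
have E (p : C -> R) : p 0 = 0 -> partials (mseq al) (fun t => p (phi t)) x = 0.
  move=> p0; have oV := @open_setC_supp phi.
  rewrite (partials_eq_on (g := cst 0) (mseq al) oV _ nx).
    by rewrite partials_cst; case: (mseq al).
  by move=> y /supp_out ->.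
by rewrite !E.
Qed.

Lemma compact_continuous_bounded S (u : Rn -> R) : compact S -> continuous u ->
  exists2 M, 0 <= M & forall x, S x -> `|u x| <= M.
Proof.
move=> cS cu; have : compact (u @` S).
  by apply: continuous_compact => //; exact: continuous_subspaceT.
move=> /compact_bounded[M [_ uM]]; exists (`|M| + 1); first exact: addr_ge0.
move=> x Sx; apply: (uM (`|M| + 1)); last by exists x.
by rewrite (le_lt_trans (ler_norm _))// ltrDl.
Qed.

Lemma cpartial_bounded phi al : test_functions phi ->
  exists2 M, 0 <= M & forall x, Normc.normc (cpartial al phi x) <= M.
Proof.
move=> [[pr pi] cS].
have [|a a0 ra] := compact_continuous_bounded (u := partials (mseq al)
  (fun t => complex.Re (phi t))) cS.
  by move=> x; case: (pr (mseq al) x).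
have [|b b0 ib] := compact_continuous_bounded (u := partials (mseq al)
  (fun t => complex.Im (phi t))) cS.
  by move=> x; case: (pi (mseq al) x).
exists (a + b); first exact: addr_ge0.
move=> x; have [Sx|nSx] := pselect (supp phi x); last first.
  by rewrite cpartial_out_supp// Normc.normc0 addr_ge0.
by apply: le_trans (normc_le_sum _) _; apply: lerD; [exact: ra | exact: ib].
Qed.

(** The definitions of the two classes apply [fine] to this norm, and [fine] is
    monotone on finite values only. *)
Lemma test_norm_fin c phi : test_functions phi ->
  test_norm c phi = (fine (test_norm c phi))%:E.
Proof.
move=> tphi.
have /choice[M M_] al : exists M : R, 0 <= M /\
    forall x, Normc.normc (cpartial al phi x) <= M.
  by have [M] := cpartial_bounded al tphi; exists M.
(* An index of degree at most c has entries at most c, so it is the value of emb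
   at one of finitely many functions, and the sum of the bounds bounds them all. *)
pose emb (be : {ffun 'I_n -> 'I_c.+1}) : @multiindex n :=
  [ffun i => nat_of_ord (be i)].
have : (test_norm c phi <= (\sum_be M (emb be))%:E)%E.
  apply/seminormP => [|x al _ alc].
    by apply: sumr_ge0 => be _; case: (M_ (emb be)).
  have -> : al = emb [ffun i => inord (al i)].
    apply/ffunP => i; rewrite !ffunE inordK// ltnS (leq_trans _ alc)//.
    by rewrite /mdeg (bigD1 i)//= leq_addr.
  apply: le_trans ((M_ _).2 x) _; rewrite (bigD1 [ffun i => inord (al i)])//=.
  by rewrite lerDl sumr_ge0// => be _; case: (M_ (emb be)).
move=> le; rewrite fineK// ge0_fin_numE; last exact: sup_nneg_ge0.
by rewrite (le_lt_trans le)// ltry.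
Qed.

Lemma fine_test_norm_ge0 c phi : 0 <= fine (test_norm c phi).
Proof. by rewrite fine_ge0//; exact: sup_nneg_ge0. Qed.

Lemma fine_test_norm_le c c' phi : test_functions phi -> (c <= c')%N ->
  fine (test_norm c phi) <= fine (test_norm c' phi).
Proof. by move=> tphi cc; rewrite -lee_fin -!test_norm_fin// le_seminorm. Qed.

Lemma normc_cpartial_le phi c al x : test_functions phi -> (mdeg al <= c)%N ->
  Normc.normc (cpartial al phi x) <= fine (test_norm c phi).
Proof.
move=> tphi alc; have := fine_test_norm_ge0 c phi.
move=> /(seminormP setT c phi)/iffLR; apply => //.
by rewrite -test_norm_fin.
Qed.

(** Differentiating in the reflected variable only produces a sign. *)
Lemma normc_cpartial_reflect phi al x y : test_functions phi ->
  Normc.normc (cpartial al (fun t => phi (y - t)) x) =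
  Normc.normc (cpartial al phi (y - x)).
Proof.
move=> [[pr pi] _]; rewrite /cpartial.
rewrite (partials_reflect y _ pr) (partials_reflect y _ pi)/=.
by rewrite !exprMn sqrr_sign !mul1r.
Qed.

Lemma cpartial0 f x : cpartial [ffun=> 0%N] f x = f x.
Proof.
rewrite /cpartial (_ : mseq _ = [::]) /=; first by case: (f x).
by apply: size0nil; rewrite size_mseq /mdeg big1// => i _; rewrite ffunE.
Qed.

Lemma normc_le_seminorm K m f x (M : R) : (seminorm K m f <= M%:E)%E -> K x ->
  Normc.normc (f x) <= M.
Proof.
move=> fM Kx; rewrite -(cpartial0 f x).
apply: (seminormP K m f (seminorm_le0 fM)).1 => //.
by rewrite /mdeg big1// => i _; rewrite ffunE.
Qed.

(** The key estimate: the distance to the delta distribution grows at most linearly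
    in the test norm. The integrand vanishes unless [y - x] is in the support of
    [phi], hence unless [y] is in [L]; there [f] is bounded uniformly over [B], and
    [L] lies in a box of finite volume. The constant term bounds the derivatives of
    [f] on [K]. *)
Lemma delta_dist_bound U (B : set (Rn -> C)) K L c :
  Cinfty_bounded U B -> compact K -> K `<=` U -> compact L -> L `<=` U ->
  exists a b : R, [/\ 0 <= a, 0 <= b & forall phi, test_functions phi ->
    sumset K (supp phi) `<=` L ->
    (delta_dist K c B phi <= (a * fine (test_norm c phi) + b)%R%:E)%E].
Proof.
move=> [_ Bb] cK KU cL LU.
have [MK BK] := Bb K c cK KU; have [ML BL] := Bb L 0%N cL LU.
have [M LM] : exists M : R, forall y i, L y -> `|y 0 i| <= M.
  have [M [_ LM]] := compact_bounded cL; exists (`|M| + 1) => y i Ly.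
  have : `|y| <= `|M| + 1.
    by apply: (LM (`|M| + 1)) => //; rewrite (le_lt_trans (ler_norm _))// ltrDl.
  apply: le_trans; rewrite [`|y|]mx_normrE.
  exact: (le_bigmax _ (fun ij : 'I_1 * 'I_n => `|y ij.1 ij.2|) (0, i)).
(* The factor 2 accounts for the real and the imaginary part. *)
pose A := @box R n M; pose v := fine (lebesgue_tuple R n A).
have v0 : 0 <= v by rewrite fine_ge0.
exists (2 * (`|ML| * v)), `|MK|; split; rewrite ?mulr_ge0//.
move=> phi tphi KphiL; set T := fine (test_norm c phi).
have T0 : 0 <= T := fine_test_norm_ge0 c phi.
apply/sup_nneg_leP; first by rewrite addr_ge0 ?mulr_ge0.
move=> _ [x [al [f [Kx alc Bf ->]]]].
apply: le_trans (le_normcD _ _) _; rewrite normcN; apply: lerD; last first.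
  apply: le_trans (ler_norm MK).
  have fK := BK f Bf; exact: (seminormP _ _ _ (seminorm_le0 fK)).1 fK _ _ Kx alc.
pose h y := f y * cpartial al (fun t => phi (y - t)) x.
have hL y : L y -> Normc.normc (h y) <= `|ML| * T.
  move=> Ly; rewrite Normc.normcM normc_cpartial_reflect//.
  rewrite ler_pM ?normc_ge0 ?normc_cpartial_le//.
  exact: le_trans (normc_le_seminorm (BL f Bf) Ly) (ler_norm ML).
have h0 y : ~ L y -> h y = 0.
  move=> nLy; suff E : Normc.normc (cpartial al (fun t => phi (y - t)) x) = 0.
    by rewrite /h (Normc.eq0_normc E) mulr0.
  rewrite normc_cpartial_reflect// cpartial_out_supp ?Normc.normc0//.
  move=> Sxy; apply/nLy/KphiL; exists x => //; exists (y - x) => //.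
  by rewrite addrC subrK.
have bound (p : C -> R) : p 0 = 0 -> (forall z, `|p z| <= Normc.normc z) ->
    `|Rintegral (lebesgue_tuple R n) setT (fun t => p (h (\row_i tnth t i)))|
     <= `|ML| * T * v.
  move=> p0 pn; apply: Rintegral_bound; rewrite ?mulr_ge0//.
  - exact: measurable_box.
  - exact: lebesgue_box_lty.
  - move=> t At; apply: le_trans (pn _) _.
    have [Ly|/h0 ->] := pselect (L (\row_i tnth t i)); first exact: hL.
    by rewrite Normc.normc0 mulr_ge0.
  - move=> t At; rewrite h0// => Ly; apply: At => i.
    by have := LM _ i Ly; rewrite mxE.
apply: le_trans (normc_le_sum _) _; rewrite /cintegral/=.
rewrite (_ : 2 * _ * T = `|ML| * T * v + `|ML| * T * v); last by ring.
by apply: lerD; apply: bound => // z; [exact: Re_le_normc | exact: Im_le_normc].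
Qed.

Lemma delta_dist_fin U (B : set (Rn -> C)) K L c phi :
  Cinfty_bounded U B -> compact K -> K `<=` U -> compact L -> L `<=` U ->
  test_functions phi -> sumset K (supp phi) `<=` L ->
  delta_dist K c B phi \is a fin_num.
Proof.
move=> Bb cK KU cL LU tphi KphiL.
have [a [b [a0 b0 /(_ _ tphi KphiL) le]]] := delta_dist_bound c Bb cK KU cL LU.
rewrite ge0_fin_numE; last exact: sup_nneg_ge0.
by rewrite (le_lt_trans le)// ltry.
Qed.

Lemma fine_delta_dist_ge0 K c (B : set (Rn -> C)) phi :
  0 <= fine (delta_dist K c B phi).
Proof. by rewrite fine_ge0//; exact: sup_nneg_ge0. Qed.

End test_function_bounds.

(** * Slices of basic elements, moderate and negligible elements *)

Section slices.
Context {R : realType} {n : nat} (Omega : set 'rV[R]_n)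
  (Omega_open : open Omega).
Local Notation C := R[i].
Local Notation Rn := 'rV[R]_n.
(* Not the family of compact subsets that bears the same name. *)
Local Notation compactly_in := Defs.compactly_in.
Implicit Types (F G : UOmega Omega -> C) (phi : Rn -> C) (x y : Rn).
Implicit Types (K L U V : set Rn).

Lemma sliceD F G phi : slice (F + G) phi = fun x => slice F phi x + slice G phi x.
Proof. by apply/funext => x; rewrite /slice; case: insub => //=; rewrite addr0. Qed.

Lemma sliceM F G phi : slice (F * G) phi = fun x => slice F phi x * slice G phi x.
Proof. by apply/funext => x; rewrite /slice; case: insub => //=; rewrite mulr0. Qed.

Definition slice_dom phi : set Rn := [set x | UOmega Omega (phi, x)].

Lemma slice_cst k phi x : slice_dom phi x ->
  slice (cst k : UOmega Omega -> C) phi x = k.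
Proof. by move=> Ux; rewrite /slice; case: insubP => //=; rewrite mem_set. Qed.

(** The points [y] such that [x + y] is in [Omega] form a neighborhood of the
    compact support, and compactness makes this uniform for nearby [x]. *)
Lemma open_slice_dom phi : test_functions phi -> open (slice_dom phi).
Proof.
move=> tphi; have [_ cS] := tphi.
rewrite openE => x [_ /= Ox xS]; rewrite /interior.
have near_supp : \forall z \near x, supp phi `<=` [set y | Omega (z + y)].
  have /compact_near_coveringP/(_ _ (nbhs x) (fun z y => Omega (z + y))) := cS.
  apply=> y Sy.
  have Oxy : nbhs (x + y) Omega.
    by apply: open_nbhs_nbhs; split=> //; apply: xS; exists x => //; exists y.
  have cadd : (z.1 + z.2 : Rn) @[z --> (x, y)] --> x + y := add_continuous (x, y).
  have [[A B] /= [Ax By] AB] := cadd _ Oxy.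
  by exists (B, A) => // -[a b] /= [Ba Ab]; exact: (AB (b, a)).
have near_O : \forall z \near x, Omega z by exact: open_nbhs_nbhs.
near=> z; split => //=; first by near: z.
move=> _ [_ -> [y Sy <-]].
by move: y Sy; near: z.
Unshelve. all: by end_near. Qed.

(** Makes the seminorms over [K] insensitive to the extension of the slices by 0. *)
Lemma sub_slice_dom U K L phi : U `<=` Omega -> compactly_in K U ->
  compactly_in L U -> test_functions phi -> sumset K (supp phi) `<=` L ->
  K `<=` slice_dom phi.
Proof.
move=> UO [_ KU] [_ LU] tphi KL x Kx; split=> //=.
    exact: UO _ (interior_subset (KU _ Kx)).
move=> _ [_ -> [y Sy <-]].
have Lxy : L (x + y) by apply: KL; exists x => //; exists y.
exact: UO _ (interior_subset (LU _ Lxy)).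
Qed.

Lemma basic_cst k : basic_elements Omega (cst k).
Proof.
move=> phi tphi; apply: csmooth_on_eq (csmooth_on_cst _ k).
  exact: open_slice_dom.
by move=> y Uy; rewrite slice_cst.
Qed.

Lemma basicD F G : basic_elements Omega F -> basic_elements Omega G ->
  basic_elements Omega (F + G).
Proof.
move=> bF bG phi tphi; rewrite sliceD.
by apply: csmooth_onD; [exact: open_slice_dom | exact: bF | exact: bG].
Qed.

Lemma basicM F G : basic_elements Omega F -> basic_elements Omega G ->
  basic_elements Omega (F * G).
Proof.
move=> bF bG phi tphi; rewrite sliceM.
by apply: csmooth_onM; [exact: open_slice_dom | exact: bF | exact: bG].
Qed.

Lemma nbhd_inI x U V : nbhd_in Omega x U -> nbhd_in Omega x V ->
  nbhd_in Omega x (U `&` V).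
Proof.
move=> [oU Ux UO] [oV Vx _]; split=> //; first exact: openI.
by move=> y [/UO].
Qed.

Lemma compactly_inI K U V : compactly_in K (U `&` V) ->
  compactly_in K U /\ compactly_in K V.
Proof. by move=> [cK]; rewrite interiorI subsetI => -[KU KV]. Qed.

Lemma compactly_in_sub K U : compactly_in K U -> K `<=` U.
Proof. by move=> [_ KU]; apply: subset_trans KU _; exact: interior_subset. Qed.

Lemma seminorm_slice_cst U K L m k phi : U `<=` Omega -> compactly_in K U ->
  compactly_in L U -> test_functions phi -> sumset K (supp phi) `<=` L ->
  (seminorm K m (slice (cst k : UOmega Omega -> C) phi) <=
   (Normc.normc k)%:E)%E.
Proof.
move=> UO KU LU tphi KL; have KV := sub_slice_dom UO KU LU tphi KL.
rewrite (seminorm_eq_on _ (g := cst k) (open_slice_dom tphi) KV); last first.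
  by move=> y; exact: slice_cst.
apply/seminormP => [|x al _ _]; first exact: normc_ge0.
rewrite /cpartial (_ : (fun=> _) = cst (complex.Re k))//.
rewrite [X in (_ +i* partials _ X _)%C](_ : _ = cst (complex.Im k))//.
rewrite !partials_cst; case: (mseq al) => [|i s] /=; first by case: k.
by rewrite expr0n/= addr0 sqrtr0; exact: normc_ge0.
Qed.

(** Turns multiplication by a scalar into a case of multiplication by a moderate
    element, both for moderate and for negligible elements. *)
Lemma moderate_cst k : moderate_elements Omega (cst k).
Proof.
split; first exact: basic_cst.
move=> x Ox; exists Omega; first by split.
move=> K L KU LU _ m.
exists 0%N, (Normc.normc k)%:P; split; first exact/nneg_polyC/normc_ge0.
by move=> phi tphi KL; rewrite hornerC; exact: (seminorm_slice_cst _ _ _ KU LU).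
Qed.

Lemma moderateD F G : moderate_elements Omega F -> moderate_elements Omega G ->
  moderate_elements Omega (F + G).
Proof.
move=> [bF mF] [bG mG]; split; first exact: basicD.
move=> x Ox; have [U nU HU] := mF x Ox; have [V nV HV] := mG x Ox.
have nUV := nbhd_inI nU nV; exists (U `&` V) => //.
move=> K L /[dup] KUV /compactly_inI[KU KV] /[dup] LUV /compactly_inI[LU LV] KL m.
have [c [p [p0 Fp]]] := HU K L KU LU KL m.
have [d [q [q0 Gq]]] := HV K L KV LV KL m.
exists (maxn c d), (p + q); split; first exact: nneg_polyD.
move=> phi tphi KphiL; have [_ _ UVO] := nUV; rewrite sliceD hornerD.
apply: (seminormD (open_slice_dom tphi)).
- exact: sub_slice_dom UVO KUV LUV tphi KphiL.
- exact: bF.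
- exact: bG.
- apply: le_trans (Fp _ tphi KphiL) _; rewrite lee_fin.
  by rewrite nneg_horner_le ?fine_test_norm_ge0 ?fine_test_norm_le ?leq_maxl.
- apply: le_trans (Gq _ tphi KphiL) _; rewrite lee_fin.
  by rewrite nneg_horner_le ?fine_test_norm_ge0 ?fine_test_norm_le ?leq_maxr.
Qed.

Lemma moderateM F G : moderate_elements Omega F -> moderate_elements Omega G ->
  moderate_elements Omega (F * G).
Proof.
move=> [bF mF] [bG mG]; split; first exact: basicM.
move=> x Ox; have [U nU HU] := mF x Ox; have [V nV HV] := mG x Ox.
have nUV := nbhd_inI nU nV; exists (U `&` V) => //.
move=> K L /[dup] KUV /compactly_inI[KU KV] /[dup] LUV /compactly_inI[LU LV] KL m.
have [c [p [p0 Fp]]] := HU K L KU LU KL m.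
have [d [q [q0 Gq]]] := HV K L KV LV KL m.
exists (maxn c d), ((2 ^ m.+2)%:R%:P * (p * q)); split.
  by do 2?apply: nneg_polyM => //; exact: nneg_polyC.
move=> phi tphi KphiL; have [_ _ UVO] := nUV; rewrite sliceM !hornerM hornerC.
apply: (seminormM (open_slice_dom tphi)).
- exact: sub_slice_dom UVO KUV LUV tphi KphiL.
- exact: bF.
- exact: bG.
- apply: le_trans (Fp _ tphi KphiL) _; rewrite lee_fin.
  by rewrite nneg_horner_le ?fine_test_norm_ge0 ?fine_test_norm_le ?leq_maxl.
- apply: le_trans (Gq _ tphi KphiL) _; rewrite lee_fin.
  by rewrite nneg_horner_le ?fine_test_norm_ge0 ?fine_test_norm_le ?leq_maxr.
Qed.

(** By [delta_dist_bound] the second argument of [lam] is at most [q.[y]], where [q]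
    is affine and [y] is the test norm; substituting [q] for the outer variable
    of [lam] gives a polynomial in [y] alone. *)
Lemma negligible_moderate : negligible_elements Omega `<=` moderate_elements Omega.
Proof.
move=> F [bF nF]; split => // x Ox; have [U nU HU] := nF x Ox.
exists U => // K L KU LU KL m.
have [c [lam [B [[lam0 _] bB FlB]]]] := HU K L KU LU KL m.
have KsU := compactly_in_sub KU; have LsU := compactly_in_sub LU.
have [a [b [a0 b0 le_delta]]] := delta_dist_bound c bB KU.1 KsU LU.1 LsU.
pose q : {poly R} := a%:P * 'X + b%:P.
exists c, lam.[q]; split.
  apply: nneg_poly_horner => //; apply: nneg_polyD; last exact: nneg_polyC.
  apply: nneg_polyM; first exact: nneg_polyC.
  by move=> i; rewrite coefX; case: eqP.
move=> phi tphi KphiL; apply: le_trans (FlB _ tphi KphiL) _; rewrite lee_fin.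
rewrite [leRHS](_ : _ = lam.[(q.[fine (test_norm c phi)])%:P].[fine (test_norm c phi)]).
  rewrite nneg_horner2_le ?fine_test_norm_ge0 ?fine_delta_dist_ge0//.
  rewrite -lee_fin fineK; last exact: delta_dist_fin bB KU.1 KsU LU.1 LsU tphi KphiL.
  by rewrite hornerD hornerM !hornerC hornerX; exact: le_delta.
by rewrite !horner_horner hornerC.
Qed.

Lemma negligible0 : negligible_elements Omega (cst 0).
Proof.
split; first exact: basic_cst.
move=> x Ox; exists Omega; first by split.
move=> K L KU LU _ m; exists 0%N, 0, set0; split.
- by split=> [i j|]; rewrite ?coef0 ?horner0// coef0.
- by split=> // K' m' _ _; exists 0.
move=> phi tphi KL; rewrite !horner0 -Normc.normc0.
exact: (seminorm_slice_cst _ _ _ KU LU).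
Qed.

Lemma Cinfty_boundedI U V B : Cinfty_bounded U B ->
  Cinfty_bounded (U `&` V) B.
Proof.
move=> [sB bB]; split=> [f /sB[fr fi]|K m cK KUV].
  by split=> s y [Uy _]; [exact: fr | exact: fi].
by apply: bB => // y /KUV[].
Qed.

Lemma Cinfty_boundedU U (B D : set (Rn -> C)) : Cinfty_bounded U B ->
  Cinfty_bounded U D -> Cinfty_bounded U (B `|` D).
Proof.
move=> [sB bB] [sD bD]; split=> [f [/sB|/sD]//|K m cK KU].
have [M BM] := bB K m cK KU; have [N DN] := bD K m cK KU.
exists (Num.max M N) => f [/BM|/DN] /le_trans; apply; rewrite lee_fin.
  by rewrite le_max lexx.
by rewrite le_max lexx orbT.
Qed.

(** Allows two negligible elements to be compared at a common order and with a common
    bounded set. *)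
Lemma negligible_bound_le U K L c c' (B B' : set (Rn -> C)) lam phi :
  compactly_in K U -> compactly_in L U -> nneg_poly_I lam ->
  Cinfty_bounded U B' -> (c <= c')%N -> B `<=` B' ->
  test_functions phi -> sumset K (supp phi) `<=` L ->
  lam.[(fine (delta_dist K c B phi))%:P].[fine (test_norm c phi)] <=
  lam.[(fine (delta_dist K c' B' phi))%:P].[fine (test_norm c' phi)].
Proof.
move=> KU LU [lam0 _] bB' cc BB tphi KphiL.
have KsU := compactly_in_sub KU; have LsU := compactly_in_sub LU.
have fn := delta_dist_fin c' bB' KU.1 KsU LU.1 LsU tphi KphiL.
rewrite nneg_horner2_le ?fine_test_norm_ge0 ?fine_delta_dist_ge0//.
  exact: fine_test_norm_le.
have le := le_delta_dist K phi cc BB.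
rewrite -lee_fin (fineK fn) fineK// ge0_fin_numE; last exact: sup_nneg_ge0.
by rewrite (le_lt_trans le)// -ge0_fin_numE//; exact: sup_nneg_ge0.
Qed.

Lemma negligibleD F G : negligible_elements Omega F ->
  negligible_elements Omega G -> negligible_elements Omega (F + G).
Proof.
move=> [bF nF] [bG nG]; split; first exact: basicD.
move=> x Ox; have [U nU HU] := nF x Ox; have [V nV HV] := nG x Ox.
have nUV := nbhd_inI nU nV; exists (U `&` V) => //.
move=> K L /[dup] KUV /compactly_inI[KU KV] /[dup] LUV /compactly_inI[LU LV] KL m.
have [c [p [B [p0 bB Fp]]]] := HU K L KU LU KL m.
have [d [q [D [q0 bD Gq]]]] := HV K L KV LV KL m.
have bBD : Cinfty_bounded (U `&` V) (B `|` D).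
  apply: Cinfty_boundedU; first exact: Cinfty_boundedI.
  by rewrite setIC; exact: Cinfty_boundedI.
exists (maxn c d), (p + q), (B `|` D); split=> //.
  case: p0 q0 => [p0 p00] [q0 q00]; split; last by rewrite hornerD p00 q00 addr0.
  by move=> i j; rewrite !coefD addr_ge0.
move=> phi tphi KphiL; have [_ _ UVO] := nUV; rewrite sliceD !hornerD.
apply: (seminormD (open_slice_dom tphi)).
- exact: sub_slice_dom UVO KUV LUV tphi KphiL.
- exact: bF.
- exact: bG.
- apply: le_trans (Fp _ tphi KphiL) _; rewrite lee_fin.
  by apply: (negligible_bound_le KUV LUV) => //; exact: leq_maxl.
- apply: le_trans (Gq _ tphi KphiL) _; rewrite lee_fin.
  by apply: (negligible_bound_le KUV LUV) => //; exact: leq_maxr.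
Qed.

Lemma negligibleM F G : moderate_elements Omega F ->
  negligible_elements Omega G -> negligible_elements Omega (F * G).
Proof.
move=> [bF mF] [bG nG]; split; first exact: basicM.
move=> x Ox; have [U nU HU] := mF x Ox; have [V nV HV] := nG x Ox.
have nUV := nbhd_inI nU nV; exists (U `&` V) => //.
move=> K L /[dup] KUV /compactly_inI[KU KV] /[dup] LUV /compactly_inI[LU LV] KL m.
have [c [p [p0 Fp]]] := HU K L KU LU KL m.
have [d [q [B [q0 bB Gq]]]] := HV K L KV LV KL m.
have bB' : Cinfty_bounded (U `&` V) B by rewrite setIC; exact: Cinfty_boundedI.
exists (maxn c d), (((2 ^ m.+2)%:R%:P * p)%:P * q), B; split=> //.
  case: q0 => [q0 q00]; split; last by rewrite hornerM q00 mulr0.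
  move=> i; rewrite coefCM; apply: nneg_polyM (q0 i).
  by apply: nneg_polyM => //; exact: nneg_polyC.
move=> phi tphi KphiL; have [_ _ UVO] := nUV.
rewrite sliceM !hornerM !hornerC hornerM hornerC -mulrA.
apply: (seminormM (open_slice_dom tphi)).
- exact: sub_slice_dom UVO KUV LUV tphi KphiL.
- exact: bF.
- exact: bG.
- apply: le_trans (Fp _ tphi KphiL) _; rewrite lee_fin.
  by rewrite nneg_horner_le ?fine_test_norm_ge0 ?fine_test_norm_le ?leq_maxl.
- apply: le_trans (Gq _ tphi KphiL) _; rewrite lee_fin.
  by apply: (negligible_bound_le KUV LUV) => //; exact: leq_maxr.
Qed.

End slices.

Unset Implicit Arguments.

Theorem proposition26 (R : realType) (n : nat) (Omega : set 'rV[R]_n)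
    (Omega_open : open Omega) :
  is_subalgebra (basic_elements Omega) (moderate_elements Omega) /\
  is_ideal (moderate_elements Omega) (negligible_elements Omega).
Proof.
have mcst := moderate_cst Omega_open.
split; split.
- by move=> F [].
- exact: mcst.
- by move=> F G; exact: moderateD.
- by move=> k F; exact: moderateM.
- by move=> F G; exact: moderateM.
- exact: negligible_moderate.
- exact: negligible0.
- by move=> F G; exact: negligibleD.
- by move=> k F; exact: negligibleM.
- by move=> F G; exact: negligibleM.
Qed.
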